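(* Let $s,t\geq 1$ be integers and let $p,q,l$ be three distinct primes with $p,q$ odd, $p\equiv 3 \pmod 4$, $\mathrm{ord}_{p^s}(l)=\phi(p^s)/2$, $\mathrm{ord}_{q^t}(l)=\phi(q^t)$ and $\gcd(\phi(p^s),\phi(q^t))=2$. Let $0\leq i\leq s-1$ and $0\leq j<j'\leq t$. Then in the ring $\mathbb{F}_l[x]/\langle x^{p^sq^t}-1\rangle$: (i) If $q$ is a quadratic residue modulo $p$, then \[\chi_{ij}^*\chi_{ij'}=\frac{p-3}{4}p^{s-i-1}\phi(q^{t-j'})(\chi_{ij}+\chi_{ij}^* )+\frac{\phi(p^{s-i})}{2}\phi(q^{t-j'})\Big(\sum_{i< k\leq s-1}(\chi_{kj}+\chi_{kj}^* )+\chi_{sj}\Big).\] (ii) If $q$ is a quadratic nonresidue modulo $p$ and $2\nmid j'-j$, then \[\chi_{ij}^*\chi_{ij'}=\frac{p-3}{4}p^{s-i-1}\phi(q^{t-j'})\chi_{ij}^*+\frac{p+1}{4}p^{s-i-1}\phi(q^{t-j'})\chi_{ij}.\] (iii) If $q$ is a quadratic nonresidue modulo $p$ and $2\mid j'-j$, then \[\chi_{ij}^*\chi_{ij'}=\frac{p-3}{4}p^{s-i-1}\phi(q^{t-j'})(\chi_{ij}+\chi_{ij}^* )+\frac{\phi(p^{s-i})}{2}\phi(q^{t-j'})\Big(\sum_{i< k\leq s-1}(\chi_{kj}+\chi_{kj}^* )+\chi_{sj}\Big).\]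
   Context: Here $\phi$ is Euler's phi function (with $\phi(1)=1$) and $\mathrm{ord}_m(k)$ is the multiplicative order of $k$ modulo $m$. Put $n=p^sq^t$. Fix an integer $g$ that is a primitive root both modulo $p^s$ and modulo $q^t$. For an integer $\gamma$, $C_\gamma=\{\gamma l^r \bmod n: r\geq 0\}\subseteq \mathbb{Z}_n$ is the $l$-cyclotomic coset modulo $n$ containing $\gamma$. For $0\leq i\leq s$, $0\leq j\leq t$ set $C_{ij}=C_{p^iq^j}$ and $C_{ij}^*=C_{p^iq^jg}$; in particular $C_{sj}=C_{sj}^*$ and $C_{st}=C_0=\{0\}$. Define elements of $\mathbb{F}_l[x]/\langle x^{n}-1\rangle$ by $\chi_{ij}=\sum_{\alpha\in C_{ij}}x^\alpha$ and $\chi_{ij}^*=\sum_{\alpha\in C_{ij}^*}x^\alpha$; in particular $\chi_{sj}=\chi_{sj}^*$ and $\chi_{st}=1$. Integer coefficients are read in $\mathbb{F}_l$, and empty sums are $0$. *)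

(* Defs.v *)
From HB Require Import structures.
From mathcomp Require Import all_boot all_order all_algebra.

Set Implicit Arguments.
Unset Strict Implicit.
Unset Printing Implicit Defensive.

Import GRing.Theory.
Local Open Scope ring_scope.

(* ord_m(k) = r.  Meaningful for 1 < m only, since 'Z_m is Z/2 when m <= 1;
   forces k to be invertible modulo m. *)
Definition mult_order_is (m : nat) (k : int) (r : nat) : bool :=
  r.-primitive_root (k%:~R : 'Z_m).

Definition primitive_root_mod (m : nat) (g : int) : bool :=
  mult_order_is m g (totient m).

Definition quadratic_residue (a m : nat) : Prop :=
  coprime a m /\ exists x : nat, (x ^ 2 = a %[mod m])%N.

Definition quadratic_nonresidue (a m : nat) : Prop :=
  coprime a m /\ ~ exists x : nat, (x ^ 2 = a %[mod m])%N.

(* {c * l ^ r mod n : r >= 0}; [fconnect f c a] says that a is some iterate of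
   f at c, see [cyclotomic_cosetP]. *)
Definition cyclotomic_coset (n l : nat) (c : int) : {set 'Z_n} :=
  [set a | fconnect (fun b : 'Z_n => b * l%:R) c%:~R a].

Lemma cyclotomic_cosetP (n l : nat) (c : int) (a : 'Z_n) :
  reflect (exists r : nat, a = c%:~R * l%:R ^+ r) (a \in cyclotomic_coset n l c).
Proof.
have iterE r : iter r (fun b : 'Z_n => b * l%:R) c%:~R = c%:~R * l%:R ^+ r.
  by elim: r => [|r IHr]; rewrite ?expr0 ?mulr1 //= IHr exprSr mulrA.
rewrite inE; apply: (iffP idP) => [/iter_findex <-|[r ->]].
  by rewrite iterE; eexists.
by rewrite -iterE fconnect_iter.
Qed.

(* F_l[x] / <x^n - 1>; [mk_monic_XnB1] shows that for 0 < n the library does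
   not replace the modulus. *)
Notation cyclic_ring l n := {poly %/ ('X^n - 1 : {poly 'F_l})}.

Lemma mk_monic_XnB1 (l n : nat) :
  (0 < n)%N -> mk_monic ('X^n - 1 : {poly 'F_l}) = 'X^n - 1.
Proof. by move=> n_gt0; rewrite /mk_monic size_XnsubC // ltnS n_gt0 monicXnsubC. Qed.

Definition coset_sum (n l : nat) (c : int) : cyclic_ring l n :=
  \sum_(a in cyclotomic_coset n l c) in_qpoly _ 'X ^+ (a : nat).

Definition chi (p q s t l i j : nat) : cyclic_ring l (p ^ s * q ^ t)%N :=
  coset_sum (p ^ s * q ^ t) l (p ^ i * q ^ j)%N%:Z.

Definition chi_star (p q s t l : nat) (g : int) (i j : nat) :
    cyclic_ring l (p ^ s * q ^ t)%N :=
  coset_sum (p ^ s * q ^ t) l ((p ^ i * q ^ j)%N%:Z * g).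

(* Main.v *)
(* The powers of l modulo p^s form a subgroup of index 2 and odd order of the
   units, i.e. the squares, and -1 is a nonsquare; modulo q^t they are all the
   units.  As these two orders are coprime, a cyclotomic coset modulo p^s q^t is
   the product of its projections modulo p^s and q^t.  Writing x = y z with y and z
   of orders dividing p^s and q^t, each chi therefore factors as a power sum in y
   over p^i times the squares, or p^i times the nonsquares, multiplied by a power
   sum in z over {v : gcd(v, q^t) = q^j}.  Multiplying by q exchanges squares and
   nonsquares exactly when q is a nonresidue modulo p.
   The z-parts multiply trivially, since for j < j' the j-th set is stable under
   translation by the j'-th one.  For the y-parts, let E and N = -E be the two
   classes and K the multiples of p^(i+1).  The number of ways to write d as a sum
   of elements of E and N is |E| for d in K, a constant m on E and N, and 0
   elsewhere; counting all pairs gives |E| = 2 m + |K|.  The squares of the power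
   sums over E and N follow from this product, as E, N and K partition the
   multiples of p^i, and E and N are stable under translation by K. *)
Require Import Defs.
From HB Require Import structures.
From mathcomp Require Import all_boot all_order all_algebra.
From mathcomp Require Import zify ring.

Set Implicit Arguments.
Unset Strict Implicit.
Unset Printing Implicit Defensive.

Import GRing.Theory.
Local Open Scope ring_scope.

(** * Multiples and gcd classes in ['Z_n], with their sizes *)

Definition multiples (n d : nat) : {set 'Z_n} := [set a : 'Z_n | d %| a]%N.

Definition gcd_class (n d : nat) : {set 'Z_n} := [set a : 'Z_n | gcdn a n == d].

Lemma multiplesE (n d k : nat) :
  (1 < n)%N -> (d %| n)%N -> ((k%:R : 'Z_n) \in multiples n d) = (d %| k)%N.
Proof.
move=> n_gt1 d_n; rewrite inE val_Zp_nat // /dvdn; congr (_ == _).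
exact: modn_dvdm.
Qed.

Lemma gcd_classE (n d k : nat) :
  (1 < n)%N -> ((k%:R : 'Z_n) \in gcd_class n d) = (gcdn k n == d).
Proof. by move=> n_gt1; rewrite inE val_Zp_nat // gcdn_modl. Qed.

(** Since [d * k < n] for [k < n %/ d], no wraparound occurs. The choices [predT] and coprimality to
    [n %/ d] for [Q] yield the sizes of [multiples] and [gcd_class]. *)
Lemma image_mul_card (n d : nat) (Q : pred nat) :
  (1 < n)%N -> (d %| n)%N ->
  #|[set ((d * k)%:R : 'Z_n) | k : 'I_(n %/ d) & Q k]|
  = #|[pred k : 'I_(n %/ d) | Q k]|.
Proof.
move=> n_gt1 d_n; rewrite card_in_imset ?cardsE //.
have d_gt0: (0 < d)%N by apply: dvdn_gt0 d_n; lia.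
move=> a b _ _ /(congr1 val) /=; rewrite -!/(nat_of_ord _) !val_Zp_nat //.
have lt_n (c : 'I_(n %/ d)) : (d * c < n)%N.
  by rewrite -[X in (_ < X)%N](divnK d_n) mulnC ltn_pmul2r.
by rewrite !modn_small // => /eqP; rewrite eqn_pmul2l // => /eqP /val_inj.
Qed.

Lemma image_mulP (n d : nat) (Q : pred nat) (a : 'Z_n) :
  (1 < n)%N -> (d %| n)%N ->
  (a \in [set ((d * k)%:R : 'Z_n) | k : 'I_(n %/ d) & Q k])
  = (d %| a)%N && Q (a %/ d)%N.
Proof.
move=> n_gt1 d_n; have d_gt0: (0 < d)%N by apply: dvdn_gt0 d_n; lia.
have lt_n (c : 'I_(n %/ d)) : (d * c < n)%N.
  by rewrite -[X in (_ < X)%N](divnK d_n) mulnC ltn_pmul2r.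
apply/imsetP/andP => [[k Qk ->]|[d_a Qa]].
  rewrite inE in Qk.
  by rewrite val_Zp_nat // modn_small // dvdn_mulr // mulKn.
have a_lt : (a < n)%N by rewrite -[X in (_ < X)%N](Zp_cast n_gt1) ltn_ord.
have lt_a : (a %/ d < n %/ d)%N by rewrite ltn_divLR // divnK.
exists (Ordinal lt_a) => //=; rewrite ?inE //=.
by rewrite mulnC divnK // natr_Zp.
Qed.

Lemma card_multiples (n d : nat) :
  (1 < n)%N -> (d %| n)%N -> #|multiples n d| = (n %/ d)%N.
Proof.
move=> n_gt1 d_n; rewrite -[RHS]card_ord.
rewrite -[RHS](@image_mul_card n d predT) //; apply: eq_card => a.
by rewrite image_mulP // inE andbT.
Qed.

Lemma gcdn_eq_divisor (n d a : nat) :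
  (0 < d)%N -> (d %| n)%N ->
  (gcdn a n == d) = (d %| a)%N && coprime (n %/ d) (a %/ d).
Proof.
move=> d_gt0 d_n; apply/idP/andP => [/eqP g_d|[d_a cop]].
  have d_a : (d %| a)%N by rewrite -g_d dvdn_gcdl.
  split=> //; move: g_d; rewrite -{1}(divnK d_a) -{1}(divnK d_n) -muln_gcdl.
  move=> /eqP; rewrite -[X in _ == X]mul1n eqn_pmul2r // => /eqP e.
  by rewrite /coprime gcdnC e.
by rewrite -(divnK d_a) -(divnK d_n) -muln_gcdl gcdnC (eqP cop) mul1n.
Qed.

Lemma card_gcd_class (n d : nat) :
  (1 < n)%N -> (d %| n)%N -> #|gcd_class n d| = totient (n %/ d).
Proof.
move=> n_gt1 d_n; have d_gt0: (0 < d)%N by apply: dvdn_gt0 d_n; lia.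
rewrite totient_count_coprime big_mkord.
transitivity #|[pred k : 'I_(n %/ d) | coprime (n %/ d) k]|.
  rewrite -(@image_mul_card n d (fun k => coprime (n %/ d)%N k)) //.
  apply: eq_card => a; rewrite image_mulP // inE.
  exact: gcdn_eq_divisor.
by rewrite -sum1_card big_mkcond; apply: eq_bigr => k _; rewrite inE; case: coprime.
Qed.

(** * Power sums over subsets of ['Z_n] and their products *)

Section PowerSums.
Variables (R : comNzRingType) (n : nat) (y : R).
Hypotheses (n_gt1 : (1 < n)%N) (yn1 : y ^+ n = 1).

Definition power_sum (A : {set 'Z_n}) : R := \sum_(a in A) y ^+ (a : nat).

Lemma expr_natZp (k : nat) : y ^+ (k%:R : 'Z_n) = y ^+ k.
Proof. by rewrite val_Zp_nat // expr_mod. Qed.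

Lemma expr_addZp (a b : 'Z_n) : y ^+ (a + b)%R = y ^+ a * y ^+ b.
Proof. by rewrite -{1}(natr_Zp a) -{1}(natr_Zp b) -natrD expr_natZp exprD. Qed.

Lemma power_sumU (A B : {set 'Z_n}) :
  [disjoint A & B] -> power_sum (A :|: B) = power_sum A + power_sum B.
Proof. by move=> dAB; rewrite /power_sum -bigU //; apply: eq_bigl => a; rewrite !inE. Qed.

(** Pairs are grouped by their sum [d]: once [a] is chosen, the other term must be [d - a]. *)
Lemma power_sumM (A B : {set 'Z_n}) :
  power_sum A * power_sum B
  = \sum_(d : 'Z_n) y ^+ (d : nat) *+ #|[set a in A | d - a \in B]|.
Proof.
have shift (a : 'Z_n) : y ^+ a * power_sum B
    = \sum_(d : 'Z_n | d - a \in B) y ^+ (d : nat).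
  rewrite mulr_sumr (reindex_inj (addIr (- a))); apply: eq_bigr => d _.
  by rewrite -expr_addZp addrC subrK.
rewrite {1}/power_sum mulr_suml; under eq_bigr do rewrite shift.
rewrite (exchange_big_dep predT) //=; apply: eq_bigr => d _.
by rewrite sumr_const; congr (_ *+ _); apply: eq_card => a; rewrite !inE.
Qed.

(** Translation by an element of [B] is injective and maps the finite set [A] into itself, hence
    permutes it. Each [y ^+ b] therefore fixes the power sum over [A]. *)
Lemma power_sumM_stable (A B : {set 'Z_n}) :
  (forall a b, a \in A -> b \in B -> a + b \in A) ->
  power_sum A * power_sum B = power_sum A *+ #|B|.
Proof.
move=> stab; rewrite {2}/power_sum mulr_sumr -sumr_const; apply: eq_bigr => b bB.
rewrite mulr_suml.
have shA : [set a + b | a in A] = A.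
  apply/eqP; rewrite eqEcard card_imset ?leqnn ?andbT; last exact: addIr.
  by apply/subsetP => _ /imsetP [a aA ->]; apply: stab.
rewrite /power_sum -{2}shA big_imset /=; last by move=> ? ? _ _; apply: addIr.
by apply: eq_bigr => a _; rewrite expr_addZp.
Qed.

Lemma power_sum_dom (A : {set 'Z_n}) :
  power_sum A = \sum_(d : 'Z_n) y ^+ (d : nat) *+ (d \in A).
Proof.
by rewrite /power_sum big_mkcond; apply: eq_bigr => d _; case: ifP.
Qed.
End PowerSums.

(** * Chinese remaindering of cyclotomic cosets *)

Lemma intr_absz_modz (R : pzRingType) (n : nat) (c : int) :
  (0 < n)%N -> n%:R = 0 :> R -> c%:~R = (`|(c %% n)%Z|%N)%:R :> R.
Proof.
move=> n_gt0 nR; rewrite {1}(divz_eq c n) intrD intrM.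
have -> : (n : int)%:~R = 0 :> R by [].
rewrite mulr0 add0r -{1}[(c %% n)%Z]gez0_abs // modz_ge0 //.
by rewrite -lt0n.
Qed.

Lemma natr_multiple (m n : nat) : (1 < m)%N -> (m %| n)%N -> n%:R = 0 :> 'Z_m.
Proof. by move=> m_gt1 /dvdnP [k ->]; rewrite natrM pchar_Zp // mulr0. Qed.

Lemma cyclotomic_coset_natP (n l k : nat) (c : int) (a : 'Z_n) :
  c%:~R = k%:R :> 'Z_n ->
  reflect (exists r : nat, a = (k * l ^ r)%:R) (a \in cyclotomic_coset n l c).
Proof.
move=> ck; apply: (iffP (@cyclotomic_cosetP n l c a)) => -[r ->]; exists r.
  by rewrite ck natrM natrX.
by rewrite ck natrM natrX.
Qed.

Lemma eq_natr_Zp (m a b : nat) :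
  (1 < m)%N -> a = b %[mod m] -> a%:R = b%:R :> 'Z_m.
Proof. by move=> m_gt1 ab; rewrite -(Zp_nat_mod m_gt1 a) ab Zp_nat_mod. Qed.

Lemma natr_Zp_mod (m a b : nat) :
  (1 < m)%N -> a%:R = b%:R :> 'Z_m -> a = b %[mod m].
Proof. by move=> m_gt1 /(congr1 val) /=; rewrite -!/(nat_of_ord _) !val_Zp_nat. Qed.

(** The exponent is 0 modulo [m2], hence a multiple of [m2]; a further factor [m1] makes it a
    multiple of [m1 * m2]. *)
Lemma expr_chinesel (R : pzSemiRingType) (m1 m2 a : nat) (x : R) :
  coprime m1 m2 -> x ^+ (m1 * m2) = 1 -> (x ^+ chinese m1 m2 a 0) ^+ m1 = 1.
Proof.
move=> co_m xn; have /dvdnP [k ->] : (m2 %| chinese m1 m2 a 0)%N.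
  by rewrite /dvdn chinese_modr // mod0n.
by rewrite -exprM -mulnA mulnC [(m2 * m1)%N]mulnC exprM xn expr1n.
Qed.

Lemma expr_chineser (R : pzSemiRingType) (m1 m2 a : nat) (x : R) :
  coprime m1 m2 -> x ^+ (m1 * m2) = 1 -> (x ^+ chinese m1 m2 0 a) ^+ m2 = 1.
Proof.
move=> co_m xn; have /dvdnP [k ->] : (m1 %| chinese m1 m2 0 a)%N.
  by rewrite /dvdn chinese_modl // mod0n.
by rewrite -exprM -mulnA mulnC exprM xn expr1n.
Qed.

(* The orders of [l] modulo [m1] and [m2] being coprime, the exponents of [l] in
   the two components of a coset can be prescribed independently. *)
Lemma power_sum_crt (R : comNzRingType) (m1 m2 l e1 e2 : nat) (c : int) (x : R) :
  (1 < m1)%N -> (1 < m2)%N -> coprime m1 m2 ->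
  (l%:R : 'Z_m1) ^+ e1 = 1 -> (l%:R : 'Z_m2) ^+ e2 = 1 -> coprime e1 e2 ->
  x ^+ (m1 * m2) = 1 ->
  power_sum x (cyclotomic_coset (m1 * m2) l c)
  = power_sum (x ^+ chinese m1 m2 1 0) (cyclotomic_coset m1 l c)
    * power_sum (x ^+ chinese m1 m2 0 1) (cyclotomic_coset m2 l c).
Proof.
move=> m1_gt1 m2_gt1 co_m le1 le2 co_e xn.
have n_gt1 : (1 < m1 * m2)%N by nia.
set n := (m1 * m2)%N in n_gt1 xn *.
set u := chinese m1 m2 1 0; set v := chinese m1 m2 0 1.
(* One natural number [k] represents [c] in all three rings ['Z_n], ['Z_m1] and ['Z_m2]. *)
pose k := `|(c %% n)%Z|%N.
have n0 : (0 < n)%N by apply: ltnW.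
have ck1 : c%:~R = k%:R :> 'Z_m1.
  by apply: intr_absz_modz => //; apply: natr_multiple (dvdn_mulr _ _).
have ck2 : c%:~R = k%:R :> 'Z_m2.
  by apply: intr_absz_modz => //; apply: natr_multiple (dvdn_mull _ _).
have ckn : c%:~R = k%:R :> 'Z_n by apply: intr_absz_modz => //; apply: pchar_Zp.
have xE (a b : nat) : a = b %[mod n] -> x ^+ a = x ^+ b.
  by move=> ab; rewrite -(expr_mod a xn) ab expr_mod.
have n_dvd a b : a = b %[mod m1] -> a = b %[mod m2] -> a = b %[mod n].
  by move=> ab1 ab2; apply/eqP; rewrite chinese_remainder //; apply/andP; split; apply/eqP.
have u1 : u = 1 %[mod m1] by apply: chinese_modl.
have u2 : u = 0 %[mod m2] by apply: chinese_modr.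
have v1 : v = 0 %[mod m1] by apply: chinese_modl.
have v2 : v = 1 %[mod m2] by apply: chinese_modr.
have yu : (x ^+ u) ^+ m1 = 1 by apply: expr_chinesel.
have zv : (x ^+ v) ^+ m2 = 1 by apply: expr_chineser.
(* [u + v] is 1 modulo both [m1] and [m2], hence modulo [n]. *)
have xuv (a : nat) : (x ^+ u) ^+ a * (x ^+ v) ^+ a = x ^+ a.
  rewrite -!exprM -exprD -mulnDl; apply: xE; apply: n_dvd.
    by rewrite -modnMml -modnDm u1 v1 mod0n addn0 modn_mod modnMml mul1n.
  by rewrite -modnMml -modnDm u2 v2 mod0n add0n modn_mod modnMml mul1n.
pose pi (a : 'Z_n) : 'Z_m1 * 'Z_m2 := ((a : nat)%:R, (a : nat)%:R).
have val_mod (m a : nat) : (m %| n)%N -> (a%:R : 'Z_n) = a %[mod m].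
  by move=> mn; rewrite val_Zp_nat // modn_dvdm.
have pi_nat (a : nat) : pi a%:R = (a%:R, a%:R).
  congr (_, _); apply: eq_natr_Zp => //; apply: val_mod.
    exact: dvdn_mulr.
  exact: dvdn_mull.
have pi_inj : injective pi.
  move=> a b [/(natr_Zp_mod m1_gt1) ab1 /(natr_Zp_mod m2_gt1) ab2].
  by rewrite -(natr_Zp a) -(natr_Zp b); apply: eq_natr_Zp => //; apply: n_dvd.
have pi_coset : pi @: cyclotomic_coset n l c
    = setX (cyclotomic_coset m1 l c) (cyclotomic_coset m2 l c).
  apply/setP => -[a b]; rewrite in_setX.
  apply/imsetP/andP => [[d]|].
    move=> /(cyclotomic_coset_natP _ _ ckn) [r ->].
    rewrite pi_nat => -[-> ->]; split.
      by apply/(cyclotomic_coset_natP _ _ ck1); exists r.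
    by apply/(cyclotomic_coset_natP _ _ ck2); exists r.
  move=> [/(cyclotomic_coset_natP _ _ ck1) [r1 ->]].
  move=> /(cyclotomic_coset_natP _ _ ck2) [r2 ->].
  pose r := chinese e1 e2 r1 r2.
  exists (k * l ^ r)%:R; first by apply/(cyclotomic_coset_natP _ _ ckn); exists r.
  rewrite pi_nat !natrM !natrX; congr (_ * _, _ * _).
    by rewrite -(expr_mod r1 le1) -(expr_mod r le1) chinese_modl.
  by rewrite -(expr_mod r2 le2) -(expr_mod r le2) chinese_modr.
rewrite /power_sum mulr_suml; under [RHS]eq_bigr do rewrite mulr_sumr.
rewrite pair_big /=.
under [RHS]eq_bigl => ab do rewrite -in_setX -surjective_pairing -pi_coset.
rewrite big_imset /=; last by move=> a b _ _; apply: pi_inj.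
apply: eq_bigr => a _; rewrite !val_Zp_nat //.
by rewrite !(expr_mod _ yu) !(expr_mod _ zv) xuv.
Qed.

Lemma in_qpolyX_expn (n l : nat) :
  (0 < n)%N -> (in_qpoly _ 'X : cyclic_ring l n) ^+ n = 1.
Proof.
move=> n_gt0; rewrite -rmorphXn /= -[X in in_qpoly _ X](subrK 1).
rewrite in_qpolyD in_qpoly1 -[RHS]add0r; congr (_ + _).
apply: val_inj; rewrite /= mk_monic_XnB1 //.
by apply: Pdiv.RingMonic.rmodpp; apply: monicXnsubC.
Qed.

(** * Gcd classes modulo prime powers, and powers of [l] among the units *)

Lemma multiplesN (n d : nat) (a : 'Z_n) :
  (1 < n)%N -> (d %| n)%N -> a \in multiples n d -> - a \in multiples n d.
Proof.
move=> n_gt1 dn aM; rewrite -mulN1r -(natr_Zp (-1)) -(natr_Zp a) -natrM.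
by rewrite multiplesE // dvdn_mull //; move: aM; rewrite inE.
Qed.

Lemma multiplesD (n d : nat) (a b : 'Z_n) :
  (1 < n)%N -> (d %| n)%N ->
  a \in multiples n d -> b \in multiples n d -> a + b \in multiples n d.
Proof.
move=> n_gt1 dn aM bM; rewrite -(natr_Zp a) -(natr_Zp b) -natrD multiplesE //.
by apply: dvdn_add; [move: aM | move: bM]; rewrite inE.
Qed.

Lemma natr_Zp_unit (n : nat) (u : 'Z_n) :
  (1 < n)%N -> (u \is a GRing.unit) = coprime n u.
Proof. by move=> n_gt1; rewrite -{1}(natr_Zp u) unitZpE. Qed.

Lemma unit_gcd_class (n : nat) (u : 'Z_n) :
  (1 < n)%N -> (u \in gcd_class n 1) = (u \is a GRing.unit).
Proof. by move=> n_gt1; rewrite natr_Zp_unit // inE coprime_sym. Qed.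

Lemma gcd_class_pfactorP (p s i : nat) (a : 'Z_(p ^ s)) :
  prime p -> (0 < s)%N -> (i <= s)%N ->
  reflect (exists2 u : 'Z_(p ^ s), u \is a GRing.unit & a = (p ^ i)%:R * u)
          (a \in gcd_class (p ^ s) (p ^ i)).
Proof.
move=> p_pr s_gt0 le_is.
have P_gt1 : (1 < p ^ s)%N by rewrite -(exp1n s) ltn_exp2r // prime_gt1.
have p_gt0 := prime_gt0 p_pr.
have pi_gt0 : (0 < p ^ i)%N by rewrite expn_gt0 p_gt0.
apply: (iffP idP) => [|[u uU ->]]; last first.
  rewrite -(natr_Zp u) -natrM gcd_classE // gcdn_eq_divisor ?dvdn_exp2l //.
  rewrite dvdn_mulr // mulKn // -expnB // coprimeXl //.
  by move: uU; rewrite natr_Zp_unit // coprime_pexpl.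
rewrite inE gcdn_eq_divisor ?dvdn_exp2l //.
case/andP=> p_a; rewrite -expnB //.
case: (ltngtP i s) le_is => // [lt_is|eq_is] _.
  rewrite coprime_pexpl ?subn_gt0 // => co.
  exists (a %/ p ^ i)%:R; first by rewrite unitZpE // coprime_pexpl.
  by rewrite -natrM mulnC divnK // natr_Zp.
(* For [i = s] the class contains only 0, and any unit would serve as witness. *)
move=> _; exists 1; first exact: unitr1.
rewrite mulr1 eq_is pchar_Zp //; apply/eqP/negbNE/negP => a_neq0.
move: p_a; rewrite eq_is; apply/negP; rewrite gtnNdvd ?lt0n //.
by rewrite -[X in (_ < X)%N](Zp_cast P_gt1) ltn_ord.
Qed.

Lemma multiples_gcd_classU (p s i : nat) :
  prime p -> (0 < s)%N -> (i < s)%N ->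
  multiples (p ^ s) (p ^ i)
  = gcd_class (p ^ s) (p ^ i) :|: multiples (p ^ s) (p ^ i.+1)
  /\ [disjoint gcd_class (p ^ s) (p ^ i) & multiples (p ^ s) (p ^ i.+1)].
Proof.
move=> p_pr s_gt0 lt_is.
have P_gt1 : (1 < p ^ s)%N by rewrite -(exp1n s) ltn_exp2r // prime_gt1.
have p_gt0 := prime_gt0 p_pr; have pi_gt0 : (0 < p ^ i)%N by rewrite expn_gt0 p_gt0.
have clE (a : 'Z_(p ^ s)) : (a \in gcd_class (p ^ s) (p ^ i)) =
    (p ^ i %| a)%N && ~~ (p ^ i.+1 %| a)%N.
  rewrite inE gcdn_eq_divisor ?dvdn_exp2l // 1?ltnW //.
  case: (boolP (p ^ i %| a)%N) => //= /dvdnP [k ->].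
  rewrite mulnK // expnS dvdn_pmul2r // -expnB ?p_gt0 // 1?ltnW //.
  by rewrite coprime_pexpl ?subn_gt0 // prime_coprime.
split.
  apply/setP => a; rewrite in_setU clE !inE.
  case: (boolP (p ^ i.+1 %| a)%N); rewrite ?andbT ?orbF //= andbF /= => pa.
  by apply: dvdn_trans pa; apply: dvdn_exp2l.
apply/pred0P => a /=; rewrite clE inE.
by case: (p ^ i.+1 %| a)%N; rewrite ?andbF.
Qed.

(** By counting: the powers with exponent below [totient n] are distinct units, and there are
    [totient n] units. *)
Lemma unit_power (n l : nat) (u : 'Z_n) :
  (1 < n)%N -> (totient n).-primitive_root (l%:R : 'Z_n) ->
  u \is a GRing.unit -> exists r, u = l%:R ^+ r.
Proof.
move=> n_gt1 l_prim uU; have o_gt0 := prim_order_gt0 l_prim.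
have lU : (l%:R : 'Z_n) \is a GRing.unit.
  by rewrite -(unitrX_pos _ o_gt0) prim_expr_order // unitr1.
pose L := [set (l%:R : 'Z_n) ^+ r | r : 'I_(totient n)].
suff : u \in L by case/imsetP => r _ ->; exists r.
suff -> : L = gcd_class n 1 by rewrite unit_gcd_class.
apply/eqP; rewrite eqEcard card_gcd_class // divn1 card_imset.
  rewrite card_ord leqnn andbT.
  by apply/subsetP => _ /imsetP [r _ ->]; rewrite unit_gcd_class // unitrX.
move=> a b /eqP; rewrite (eq_prim_root_expr l_prim) !modn_small //.
by move/eqP/val_inj.
Qed.

(** By counting again: the [o] powers of [l] and their [o] opposites are disjoint sets of units, and
    together they have [totient n] elements. *)
Lemma unit_power_sign (n l o : nat) (u : 'Z_n) :
  (1 < n)%N -> o.-primitive_root (l%:R : 'Z_n) -> totient n = o.*2 ->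
  (forall a b, (l%:R : 'Z_n) ^+ a != - l%:R ^+ b) ->
  u \is a GRing.unit -> exists r, u = l%:R ^+ r \/ u = - l%:R ^+ r.
Proof.
move=> n_gt1 l_prim oE l_neqN uU; have o_gt0 := prim_order_gt0 l_prim.
have lU : (l%:R : 'Z_n) \is a GRing.unit.
  by rewrite -(unitrX_pos _ o_gt0) prim_expr_order // unitr1.
pose L := [set (l%:R : 'Z_n) ^+ r | r : 'I_o].
pose L' := [set - (l%:R : 'Z_n) ^+ r | r : 'I_o].
suff : u \in L :|: L'.
  by case/setUP => /imsetP [r _ ->]; exists r; [left|right].
have inj : injective (fun r : 'I_o => (l%:R : 'Z_n) ^+ r).
  move=> a b /eqP; rewrite (eq_prim_root_expr l_prim) !modn_small //.
  by move/eqP/val_inj.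
suff -> : L :|: L' = gcd_class n 1 by rewrite unit_gcd_class.
apply/eqP; rewrite eqEcard card_gcd_class // divn1 oE cardsU.
rewrite [X in (_ - X)%N](_ : _ = 0%N) ?subn0; last first.
  apply/eqP; rewrite cards_eq0; apply/eqP/setP => a; rewrite !inE.
  apply/negP => /andP [/imsetP [r _ ->] /imsetP [r' _ /eqP]].
  by apply/negP.
rewrite !card_imset ?card_ord ?addnn ?leqnn ?andbT //; last first.
  by move=> a b /oppr_inj /inj.
apply/subsetP => _ /setUP [] /imsetP [r _ ->].
  by rewrite unit_gcd_class // unitrX.
by rewrite unit_gcd_class // unitrN unitrX.
Qed.

Lemma eq_cyclotomic_coset (n l o r : nat) (c c' : int) :
  (0 < o)%N -> (l%:R : 'Z_n) ^+ o = 1 ->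
  c%:~R = c'%:~R * l%:R ^+ r :> 'Z_n ->
  cyclotomic_coset n l c = cyclotomic_coset n l c'.
Proof.
move=> o_gt0 lo cc'; apply/setP => a.
apply/cyclotomic_cosetP/cyclotomic_cosetP => -[k ->].
  by exists (r + k)%N; rewrite cc' -mulrA -exprD.
(* The exponent [r * o.-1] undoes [r], because [r + r * o.-1 = r * o]. *)
exists (r * o.-1 + k)%N; rewrite cc' -mulrA -exprD addnA -mulnS prednK //.
by rewrite exprD mulnC exprM lo expr1n mul1r.
Qed.

(** Meant for the modulus [q ^ t], where [l] generates all units: multiplying [w] by powers of [l]
    reaches every unit. *)
Lemma gcd_class_coset (p s l i : nat) (c : int) (w : 'Z_(p ^ s)) :
  prime p -> (0 < s)%N -> (i <= s)%N ->
  (totient (p ^ s)).-primitive_root (l%:R : 'Z_(p ^ s)) ->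
  w \is a GRing.unit -> c%:~R = (p ^ i)%:R * w ->
  cyclotomic_coset (p ^ s) l c = gcd_class (p ^ s) (p ^ i).
Proof.
move=> p_pr s_gt0 le_is l_prim wU cE.
have P_gt1 : (1 < p ^ s)%N by rewrite -(exp1n s) ltn_exp2r // prime_gt1.
have o_gt0 := prim_order_gt0 l_prim.
have lU : (l%:R : 'Z_(p ^ s)) \is a GRing.unit.
  by rewrite -(unitrX_pos _ o_gt0) prim_expr_order // unitr1.
apply/setP => a; apply/cyclotomic_cosetP/gcd_class_pfactorP => // -[].
  move=> r ->; exists (w * l%:R ^+ r); last by rewrite cE mulrA.
  by rewrite unitrM wU unitrX.
move=> u uU ->.
have [|r rE] := @unit_power _ l (w^-1 * u) P_gt1 l_prim.
  by rewrite unitrM unitrV wU.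
by exists r; rewrite cE -rE -mulrA mulVKr.
Qed.

(** For units [u] and [v], [p ^ j * u + p ^ j' * v] equals [p ^ j * (u + p ^ (j' - j) * v)]. The
    second factor is congruent to [u] modulo [p], hence a unit, so the [j]-th class is stable under
    translation by the [j']-th. *)
Lemma power_sum_gcd_classM (R : comNzRingType) (y : R) (p s j j' : nat) :
  prime p -> (0 < s)%N -> (j < j')%N -> (j' <= s)%N -> y ^+ (p ^ s) = 1 ->
  power_sum y (gcd_class (p ^ s) (p ^ j)) * power_sum y (gcd_class (p ^ s) (p ^ j'))
  = power_sum y (gcd_class (p ^ s) (p ^ j)) *+ totient (p ^ (s - j')).
Proof.
move=> p_pr s_gt0 lt_jj' le_j's yP.
have P_gt1 : (1 < p ^ s)%N by rewrite -(exp1n s) ltn_exp2r // prime_gt1.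
rewrite power_sumM_stable // ?card_gcd_class ?dvdn_exp2l // -?expnB ?prime_gt0 //.
have lt_js : (j < s)%N by apply: leq_trans le_j's.
move=> a b /(gcd_class_pfactorP _ p_pr s_gt0 (ltnW lt_js)) [u uU ->].
case/(gcd_class_pfactorP _ p_pr s_gt0 le_j's) => v vU ->.
apply/gcd_class_pfactorP; rewrite // 1?ltnW //.
exists (u + (p ^ (j' - j))%:R * v).
  rewrite -(natr_Zp u) -(natr_Zp v) -natrM -natrD unitZpE // coprime_pexpl //.
  rewrite -[(j' - j)%N]prednK ?subn_gt0 // expnS -mulnA mulnC addnC /coprime gcdnMDl.
  by move: uU; rewrite natr_Zp_unit // coprime_pexpl.
by rewrite mulrDr mulrA -natrM -expnD subnKC // ltnW.
Qed.

(** * Squares and nonsquares modulo [p ^ s] *)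

Section SquareCosets.
Variables (p s l o : nat).
Hypotheses (p_pr : prime p) (p_odd : odd p) (s_gt0 : (0 < s)%N) (o_odd : odd o).
Hypotheses (l_prim : o.-primitive_root (l%:R : 'Z_(p ^ s))).
Hypothesis oE : totient (p ^ s) = o.*2.

Let P_gt1 : (1 < p ^ s)%N.
Proof. by rewrite -(exp1n s) ltn_exp2r // prime_gt1. Qed.

Let o_gt0 : (0 < o)%N.
Proof. exact: prim_order_gt0 l_prim. Qed.

(* [l] has odd order modulo [p], hence so does each of its powers, while [-1]
   has order 2. *)
Lemma prime_Ndvd_expnD (a b : nat) : ~~ (p %| l ^ a + l ^ b)%N.
Proof.
apply/negP => p_dvd.
have lo : l%:R ^+ o = 1 :> 'F_p.
  have e : (l ^ o = 1 %[mod p])%N.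
    have pP : (p %| p ^ s)%N by rewrite -{1}(expn1 p) dvdn_exp2l.
    rewrite -(modn_dvdm _ pP) -[in RHS](modn_dvdm _ pP); congr (_ %% _)%N.
    by apply: natr_Zp_mod => //; rewrite natrX prim_expr_order.
  rewrite -natrX (divn_eq (l ^ o) p) e modn_small ?prime_gt1 // natrD natrM.
  by rewrite (pcharf0 (pchar_Fp p_pr)) mulr0 add0r.
have /eqP : (l ^ a + l ^ b)%:R = 0 :> 'F_p.
  by apply/eqP; rewrite -(dvdn_pcharf (pchar_Fp p_pr)).
rewrite natrD !natrX addr_eq0 => /eqP /(congr1 (fun x => x ^+ o)).
rewrite exprNn -signr_odd o_odd expr1 mulN1r -!exprM !(mulnC _ o) !exprM lo !expr1n.
move/eqP; rewrite -addr_eq0 -mulr2n -(dvdn_pcharf (pchar_Fp p_pr)) => /dvdn_leq.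
by move=> /(_ isT); case: p p_pr p_odd => [|[|[|]]].
Qed.

Let l_neqN (a b : nat) : (l%:R : 'Z_(p ^ s)) ^+ a != - l%:R ^+ b.
Proof.
apply: contra (prime_Ndvd_expnD a b) => /eqP lab.
have pP : (p %| p ^ s)%N by rewrite -{1}(expn1 p) dvdn_exp2l.
by rewrite -(multiplesE _ P_gt1 pP) natrD !natrX lab addNr inE dvdn0.
Qed.

Lemma square_or_opp (u : 'Z_(p ^ s)) :
  u \is a GRing.unit -> exists r, u = l%:R ^+ r \/ u = - l%:R ^+ r.
Proof. exact: unit_power_sign P_gt1 l_prim oE l_neqN. Qed.

(* [p ^ i] times the squares, resp. the nonsquares. *)
Definition sq_coset (i : nat) := cyclotomic_coset (p ^ s) l (p ^ i)%N%:Z.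
Definition nsq_coset (i : nat) := cyclotomic_coset (p ^ s) l (- (p ^ i)%N%:Z).

Lemma sq_cosetP (i : nat) (a : 'Z_(p ^ s)) :
  reflect (exists r, a = (p ^ i)%:R * l%:R ^+ r) (a \in sq_coset i).
Proof.
exact: (iffP (@cyclotomic_cosetP _ l (p ^ i)%N%:Z a)) => -[r ->]; exists r.
Qed.

Lemma opp_sq_coset (i : nat) (a : 'Z_(p ^ s)) :
  (- a \in sq_coset i) = (a \in nsq_coset i).
Proof.
apply/sq_cosetP/cyclotomic_cosetP => -[r ar]; exists r.
  by rewrite -[a]opprK ar mulrNz mulNr.
by rewrite ar mulrNz mulNr opprK.
Qed.

Lemma gcd_class_sqU (i : nat) : (i < s)%N ->
  gcd_class (p ^ s) (p ^ i) = sq_coset i :|: nsq_coset i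
  /\ [disjoint sq_coset i & nsq_coset i].
Proof.
move=> lt_is; split.
  apply/setP => a; rewrite in_setU -opp_sq_coset.
  apply/(gcd_class_pfactorP _ p_pr s_gt0 (ltnW lt_is))/orP.
    case=> u /square_or_opp [r [] -> ->]; [left|right]; apply/sq_cosetP; exists r => //.
    by rewrite mulrN opprK.
  have lU r : (l%:R : 'Z_(p ^ s)) ^+ r \is a GRing.unit.
    by rewrite unitrX // -(unitrX_pos _ o_gt0) prim_expr_order // unitr1.
  case=> /sq_cosetP [r ar]; first by exists (l%:R ^+ r).
  by exists (- l%:R ^+ r); rewrite ?unitrN // mulrN -ar opprK.
apply/pred0P => a /=; apply/negP; rewrite -opp_sq_coset.
case/andP=> /sq_cosetP [r ->] /sq_cosetP [r'] /eqP.
rewrite -subr_eq0 -opprD oppr_eq0 -mulrDr => /eqP e0.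
have := prime_Ndvd_expnD r r'; apply/negP/negPn.
(* As [i < s], vanishing modulo [p ^ s] implies divisibility by [p ^ i.+1]; cancelling [p ^ i]
   leaves a factor [p] in [l ^ r + l ^ r']. *)
rewrite -(@dvdn_pmul2l (p ^ i)) ?expn_gt0 ?prime_gt0 // mulnC -expnS mulnC.
rewrite -(@multiplesE (p ^ s)) ?dvdn_exp2l // natrM natrD !natrX.
by rewrite mulrC -natrX e0 inE dvdn0.
Qed.

(** Adding a multiple of [p ^ i.+1] changes the cofactor [l ^ r] to [l ^ r + k * p]. This is still a
    unit, so it is a power of [l] up to sign, and a minus sign would make [p] divide a sum of two
    powers of [l]. *)
Lemma sq_coset_periodic (i : nat) (a b : 'Z_(p ^ s)) : (i < s)%N ->
  a \in sq_coset i -> b \in multiples (p ^ s) (p ^ i.+1) -> a + b \in sq_coset i.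
Proof.
move=> lt_is /sq_cosetP [r ->]; rewrite inE => /dvdnP [k bk].
have pP : (p %| p ^ s)%N by rewrite -{1}(expn1 p) dvdn_exp2l.
have abE : (p ^ i)%:R * l%:R ^+ r + b = (p ^ i)%:R * (l ^ r + k * p)%:R.
  rewrite -[b]natr_Zp bk -natrX -!natrM -natrD; congr (_%:R).
  by rewrite expnS; ring.
have uU : (l ^ r + k * p)%:R \is a @GRing.unit 'Z_(p ^ s).
  rewrite unitZpE // coprime_pexpl // addnC /coprime gcdnMDl -/(coprime _ _).
  rewrite coprimeXr // -(coprime_pexpl _ _ s_gt0) -unitZpE //.
  by rewrite -(unitrX_pos _ o_gt0) prim_expr_order // unitr1.
rewrite abE; apply/sq_cosetP.
have [r' [->|/eqP]] := square_or_opp uU; first by exists r'.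
rewrite -addr_eq0 -natrX -natrD => /eqP e0.
case/negP: (prime_Ndvd_expnD r r').
have : (p %| l ^ r + k * p + l ^ r')%N by rewrite -(multiplesE _ P_gt1 pP) e0 inE dvdn0.
by rewrite addnAC dvdn_addl // dvdn_mull.
Qed.

Lemma sq_coset_mull (i r : nat) (a : 'Z_(p ^ s)) :
  a \in sq_coset i -> a * l%:R ^+ r \in sq_coset i.
Proof.
by move=> /sq_cosetP [k ->]; apply/sq_cosetP; exists (k + r)%N; rewrite -mulrA exprD.
Qed.

(** * Counting representations as a sum of a square and a nonsquare *)

Let sums (i : nat) (d : 'Z_(p ^ s)) := [set a in sq_coset i | d - a \in nsq_coset i].

(** Nonsquares being opposites of squares, representations of [d] become pairs of elements of
    [sq_coset i] with difference [d]. In this form the symmetries of the count are visible. *)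
Let in_sums (i : nat) (a d : 'Z_(p ^ s)) :
  (a \in sums i d) = (a \in sq_coset i) && (a - d \in sq_coset i).
Proof. by rewrite inE -opp_sq_coset opprB. Qed.

Let card_sums_mull (i r : nat) (d : 'Z_(p ^ s)) :
  #|sums i (d * l%:R ^+ r)| = #|sums i d|.
Proof.
have le_card k (c : 'Z_(p ^ s)) : (#|sums i c| <= #|sums i (c * l%:R ^+ k)%R|)%N.
  have inj : injective (fun a : 'Z_(p ^ s) => a * l%:R ^+ k).
    apply: mulIr; rewrite unitrX // -(unitrX_pos _ o_gt0) prim_expr_order //.
    exact: unitr1.
  rewrite -(card_imset _ inj); apply: subset_leq_card.
  apply/subsetP => _ /imsetP [a + ->]; rewrite !in_sums => /andP [aE adE].
  by rewrite -mulrBl !sq_coset_mull.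
apply/eqP; rewrite eqn_leq le_card andbT.
(* A second scaling, by [l ^ (r * o.-1)], brings [d * l ^ r] back to [d] and gives the reverse
   inequality. *)
have := le_card (r * o.-1)%N (d * l%:R ^+ r).
rewrite -mulrA -exprD -mulnS prednK // [(r * o)%N]mulnC exprM.
by rewrite (prim_expr_order l_prim) expr1n mulr1.
Qed.

(** Exchanging the two members [a] and [a - d] of a pair negates their difference. *)
Let card_sums_opp (i : nat) (d : 'Z_(p ^ s)) : #|sums i (- d)| = #|sums i d|.
Proof.
have le_card (c : 'Z_(p ^ s)) : (#|sums i c| <= #|sums i (- c)%R|)%N.
  rewrite -(card_imset _ (addIr (- c))); apply: subset_leq_card.
  apply/subsetP => _ /imsetP [a + ->]; rewrite !in_sums => /andP [aE ->].
  by rewrite opprK subrK.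
by apply/eqP; rewrite eqn_leq le_card andbT -{2}[d]opprK le_card.
Qed.

(** Every element of the gcd class is [p ^ i] times a power of [l] up to sign, so the two symmetries
    make the count constant there. For [d] a multiple of [p ^ i.+1], periodicity puts [a - d] in
    [sq_coset i] for each [a] in it. Any other [d] is not a multiple of [p ^ i], unlike a difference
    of two elements of [sq_coset i]. *)
Let card_sumsE (i : nat) (d : 'Z_(p ^ s)) : (i < s)%N ->
  #|sums i d| = (#|sums i (p ^ i)%:R| * (d \in gcd_class (p ^ s) (p ^ i))
                 + #|sq_coset i| * (d \in multiples (p ^ s) (p ^ i.+1)))%N.
Proof.
move=> lt_is; have [clE _] := gcd_class_sqU lt_is.
have [mE dis] := multiples_gcd_classU p_pr s_gt0 lt_is.
have [dC|dC] /= := boolP (d \in gcd_class _ _).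
  rewrite (disjointFr dis dC) muln1 muln0 addn0.
  move: dC; rewrite clE in_setU -opp_sq_coset.
  case/orP => /sq_cosetP [r]; first by move=> ->; rewrite card_sums_mull.
  by move=> dr; rewrite -card_sums_opp dr card_sums_mull.
rewrite muln0 add0n; have [dK|dK] := boolP (d \in multiples _ _).
  rewrite muln1; apply: eq_card => a; rewrite in_sums andb_idr // => aE.
  by rewrite sq_coset_periodic // multiplesN // dvdn_exp2l.
rewrite muln0; apply: eq_card0 => a; rewrite in_sums; apply/negP => /andP [aE adE].
have sub (c : 'Z_(p ^ s)) : c \in sq_coset i -> c \in multiples (p ^ s) (p ^ i).
  by move=> cE; rewrite mE clE !in_setU cE.
have : d \in multiples (p ^ s) (p ^ i).
  have {1}-> : d = a + - (a - d) by rewrite opprB addrC subrK.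
  by rewrite multiplesD ?multiplesN ?sub // ?dvdn_exp2l // ltnW.
by rewrite mE in_setU (negPf dC) (negPf dK).
Qed.

Lemma card_nsq_coset (i : nat) : #|nsq_coset i| = #|sq_coset i|.
Proof.
rewrite -(card_imset _ (@oppr_inj 'Z_(p ^ s))).
apply: eq_card => a; apply/imsetP/idP => [[b + ->]|aE].
  by rewrite -opp_sq_coset.
by exists (- a); rewrite ?opprK // -opp_sq_coset opprK.
Qed.

Lemma card_sq_coset (i : nat) :
  (i < s)%N -> (#|sq_coset i|.*2 = totient (p ^ (s - i)))%N.
Proof.
move=> lt_is; have [clE dis] := gcd_class_sqU lt_is; have le_is := ltnW lt_is.
rewrite expnB ?prime_gt0 // -card_gcd_class ?dvdn_exp2l //.
by rewrite clE cardsU disjoint_setI0 // cards0 subn0 card_nsq_coset addnn.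
Qed.

Let power_sum_sqM (R : comNzRingType) (y : R) (i : nat) :
  y ^+ (p ^ s) = 1 -> (i < s)%N ->
  power_sum y (sq_coset i) * power_sum y (nsq_coset i)
  = (power_sum y (sq_coset i) + power_sum y (nsq_coset i)) *+ #|sums i (p ^ i)%:R|
    + power_sum y (multiples (p ^ s) (p ^ i.+1)) *+ #|sq_coset i|.
Proof.
move=> yP lt_is; have [clE disE] := gcd_class_sqU lt_is.
rewrite power_sumM // -power_sumU // -clE !power_sum_dom -!sumrMnl -big_split /=.
apply: eq_bigr => d _; rewrite -/(sums i d) card_sumsE // mulrnDr.
by rewrite -!mulrnA [(_ * (d \in gcd_class _ _))%N]mulnC [(_ * (d \in _))%N]mulnC.
Qed.

(* At [y = 1] in [int], [power_sum_sqM] counts all the pairs. *)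
Let card_sums (i : nat) : p = 3 %[mod 4] -> (i < s)%N ->
  #|sums i (p ^ i)%:R| = ((p - 3) %/ 4 * p ^ (s - i - 1))%N.
Proof.
move=> p3 lt_is; have [clE dis] := gcd_class_sqU lt_is.
have y1 : (1 : int) ^+ (p ^ s) = 1 by rewrite expr1n.
have ps1 (A : {set 'Z_(p ^ s)}) : power_sum (1 : int) A = #|A|%:R.
  by rewrite /power_sum; under eq_bigr do rewrite expr1n; rewrite sumr_const.
have := power_sum_sqM y1 lt_is; rewrite !ps1 card_nsq_coset.
rewrite card_multiples ?dvdn_exp2l // -expnB ?prime_gt0 //.
have := card_sq_coset lt_is; rewrite totient_pfactor ?subn_gt0 //.
rewrite -[(s - i).-1]subn1 [(s - i.+1)%N]subnS -[(s - i).-1]subn1.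
have K_gt0 : (0 < p ^ (s - i - 1))%N by rewrite expn_gt0 prime_gt0.
move: #|sums i _| #|sq_coset i| (p ^ _)%N K_gt0 => m h K K_gt0.
have [c pE] : exists c, p = (4 * c + 3)%N.
  by exists (p %/ 4)%N; rewrite {1}(divn_eq p 4) p3 mulnC.
rewrite -natrD -!natrM -!mulrnA -natrD => hE /eqP.
rewrite Num.Theory.eqr_nat pE addnK mulKn // => /eqP hhE.
(* Here [h.*2 = p.-1 * K] with [p = 4 * c + 3]. *)
have {}hE : h = ((c.*2 + 1) * K)%N by lia.
subst h; have h_gt0 : (0 < (c.*2 + 1) * K)%N by nia.
(* The count reads [h * h = 2 * h * m + K * h]; cancelling [h] gives [m = c * K]. *)
apply/eqP; rewrite -(eqn_pmul2l h_gt0); apply/eqP; nia.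
Qed.

Lemma power_sum_sq_nsq (R : comNzRingType) (y : R) (i : nat) :
  y ^+ (p ^ s) = 1 -> p = 3 %[mod 4] -> (i < s)%N ->
  power_sum y (nsq_coset i) * power_sum y (sq_coset i)
  = (power_sum y (sq_coset i) + power_sum y (nsq_coset i))
      *+ ((p - 3) %/ 4 * p ^ (s - i - 1))
    + power_sum y (multiples (p ^ s) (p ^ i.+1)) *+ (totient (p ^ (s - i)) %/ 2).
Proof.
move=> yP p3 lt_is; rewrite mulrC power_sum_sqM // card_sums // -card_sq_coset //.
by rewrite -muln2 mulnK.
Qed.

(** Stated for an abstract pair [A], [B] so that it applies to squares and nonsquares in either
    order. *)
Let power_sum_square (R : comNzRingType) (y : R) (i : nat) (A B : {set 'Z_(p ^ s)}) :
  y ^+ (p ^ s) = 1 -> p = 3 %[mod 4] -> (i < s)%N ->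
  gcd_class (p ^ s) (p ^ i) = A :|: B -> [disjoint A & B] ->
  #|A|.*2 = totient (p ^ (s - i)) ->
  (forall a b, a \in A -> b \in multiples (p ^ s) (p ^ i.+1) -> a + b \in A) ->
  power_sum y A * power_sum y B
  = (power_sum y A + power_sum y B) *+ ((p - 3) %/ 4 * p ^ (s - i - 1))
    + power_sum y (multiples (p ^ s) (p ^ i.+1)) *+ #|A| ->
  power_sum y A * power_sum y A
  = power_sum y A *+ ((p - 3) %/ 4 * p ^ (s - i - 1))
    + power_sum y B *+ ((p + 1) %/ 4 * p ^ (s - i - 1)).
Proof.
move=> yP p3 lt_is clE disE cardA perA AB; have le_is := ltnW lt_is.
have [mE dis] := multiples_gcd_classU p_pr s_gt0 lt_is.
have mA : power_sum y (multiples (p ^ s) (p ^ i)) * power_sum y A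
    = power_sum y (multiples (p ^ s) (p ^ i)) *+ #|A|.
  apply: power_sumM_stable => // a b aM bA; rewrite multiplesD ?dvdn_exp2l //.
  by rewrite mE clE !in_setU bA.
have AK := power_sumM_stable P_gt1 yP perA.
rewrite card_multiples ?dvdn_exp2l // -expnB ?prime_gt0 // in AK.
move: mA AK AB; rewrite mE clE !power_sumU -?clE //.
move: cardA; rewrite totient_pfactor ?subn_gt0 //.
rewrite -[(s - i).-1]subn1 [(s - i.+1)%N]subnS -[(s - i).-1]subn1.
have [k pE] : exists k, p = (4 * k + 3)%N.
  by exists (p %/ 4)%N; rewrite {1}(divn_eq p 4) p3 mulnC.
have -> : ((p - 3) %/ 4 = k)%N by rewrite pE addnK mulKn.
have -> : ((p + 1) %/ 4 = k + 1)%N by rewrite pE -addnA -(mulnDr 4 k 1) mulKn.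
move: #|A| (p ^ (s - i - 1))%N (power_sum y A) (power_sum y B)
  (power_sum y (multiples _ _)) => h K a b c hE.
have {hE} -> : h = (2 * k * K + K)%N by lia.
move=> mA AK AB.
(* [a + b + c] is the power sum over all multiples of [p ^ i], so each product on the right is
   known. The coefficient of [a] becomes [h - k * K - K = k * K], that of [b] becomes
   [h - k * K = (k + 1) * K], and [c] cancels. *)
have -> : a * a = (a + b + c) * a - a * b - a * c by ring.
by rewrite mA AB AK; ring.
Qed.

Lemma power_sum_sq_sq (R : comNzRingType) (y : R) (i : nat) :
  y ^+ (p ^ s) = 1 -> p = 3 %[mod 4] -> (i < s)%N ->
  power_sum y (sq_coset i) * power_sum y (sq_coset i)
  = power_sum y (sq_coset i) *+ ((p - 3) %/ 4 * p ^ (s - i - 1))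
    + power_sum y (nsq_coset i) *+ ((p + 1) %/ 4 * p ^ (s - i - 1)).
Proof.
move=> yP p3 lt_is; have [clE dis] := gcd_class_sqU lt_is.
apply: power_sum_square => //; first exact: card_sq_coset.
  by move=> a b; apply: sq_coset_periodic.
by rewrite power_sum_sqM // card_sums.
Qed.

Lemma power_sum_nsq_nsq (R : comNzRingType) (y : R) (i : nat) :
  y ^+ (p ^ s) = 1 -> p = 3 %[mod 4] -> (i < s)%N ->
  power_sum y (nsq_coset i) * power_sum y (nsq_coset i)
  = power_sum y (nsq_coset i) *+ ((p - 3) %/ 4 * p ^ (s - i - 1))
    + power_sum y (sq_coset i) *+ ((p + 1) %/ 4 * p ^ (s - i - 1)).
Proof.
move=> yP p3 lt_is; have [clE dis] := gcd_class_sqU lt_is.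
apply: power_sum_square => //.
- by rewrite setUC.
- by rewrite disjoint_sym.
- by rewrite card_nsq_coset card_sq_coset.
- move=> a b; rewrite -!opp_sq_coset opprD => aE bK.
  by rewrite sq_coset_periodic // multiplesN // dvdn_exp2l.
by rewrite mulrC power_sum_sqM // card_sums // card_nsq_coset
  [power_sum y (nsq_coset i) + _]addrC.
Qed.

(** Descending induction on [i]: each step splits off one gcd class, down to [i = s], where only 0
    is left and it forms [sq_coset s]. *)
Lemma power_sum_multiples (R : comNzRingType) (y : R) (i : nat) : (i <= s)%N ->
  power_sum y (multiples (p ^ s) (p ^ i))
  = \sum_(i <= k < s) (power_sum y (sq_coset k) + power_sum y (nsq_coset k))
    + power_sum y (sq_coset s).
Proof.
move=> le_is; rewrite -(subKn le_is); move: (s - i)%N (leq_subr i s) => m.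
elim: m => [|m IHm] lt_ms.
  rewrite subn0 big_geq // add0r; congr power_sum; apply/setP => a; rewrite inE.
  have a_lt : (a < p ^ s)%N by rewrite -[X in (_ < X)%N](Zp_cast P_gt1) ltn_ord.
  apply/idP/sq_cosetP => [pa|[r ->]]; last by rewrite pchar_Zp // mul0r dvdn0.
  exists 0%N; rewrite pchar_Zp // mul0r; apply/eqP; rewrite -val_eqE /= -leqn0.
  by rewrite leqNgt; apply: contraL pa => a_gt0; rewrite gtnNdvd.
have lt_s : (s - m.+1 < s)%N by rewrite ltn_subrL.
have [clE disE] := gcd_class_sqU lt_s.
have [-> dis] := multiples_gcd_classU p_pr s_gt0 lt_s.
have Sm : ((s - m.+1).+1 = s - m)%N by rewrite -subSn.
rewrite power_sumU // clE power_sumU // Sm IHm ?(ltnW lt_ms) // -Sm.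
by rewrite [in RHS]big_ltn // !addrA.
Qed.

(** A square root of [q] modulo [p] is a power of [l] up to sign, so [q] is congruent modulo [p] to
    an even power of [l]. It cannot then be the opposite of a power of [l]. *)
Lemma residue_power (q : nat) :
  quadratic_residue q p -> exists r, q%:R = l%:R ^+ r :> 'Z_(p ^ s).
Proof.
move=> [co_qp [x xq]].
have pP : (p %| p ^ s)%N by rewrite -{1}(expn1 p) dvdn_exp2l.
have unitE (a : nat) : coprime a p -> (a%:R : 'Z_(p ^ s)) \is a GRing.unit.
  by move=> co; rewrite unitZpE // coprime_pexpl // coprime_sym.
have [r [->|qr]] := square_or_opp (unitE _ co_qp); first by exists r.
have co_xp : coprime x p by rewrite -(@coprime_pexpl 2) // -coprime_modl xq coprime_modl.
have [k xk] := square_or_opp (unitE _ co_xp).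
case/negP: (prime_Ndvd_expnD (k * 2) r).
have xlk : (x ^ 2)%:R = (l ^ (k * 2))%:R :> 'Z_(p ^ s).
  by rewrite !natrX exprM; case: xk => ->; rewrite ?sqrrN.
have /eqP lkq : (l ^ (k * 2) = q %[mod p])%N.
  by rewrite -xq -(modn_dvdm _ pP) -(natr_Zp_mod P_gt1 xlk) modn_dvdm.
rewrite /dvdn -modnDml (eqP lkq) modnDml -/(dvdn _ _).
by rewrite -(multiplesE _ P_gt1 pP) natrD qr natrX addNr inE dvdn0.
Qed.

Lemma nonresidue_power (q : nat) :
  quadratic_nonresidue q p -> exists r, q%:R = - l%:R ^+ r :> 'Z_(p ^ s).
Proof.
move=> [co_qp nsq].
have pP : (p %| p ^ s)%N by rewrite -{1}(expn1 p) dvdn_exp2l.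
have qU : (q%:R : 'Z_(p ^ s)) \is a GRing.unit.
  by rewrite unitZpE // coprime_pexpl // coprime_sym.
have [r [qr|->]] := square_or_opp qU; last by exists r.
(* Every power of [l] is a square: as [o] is odd, adding [o] to an odd exponent makes it even
   without changing the power. *)
case: nsq; pose k := (r + odd r * o)./2; exists (l ^ k)%N.
have k2 : (k * 2 = r + odd r * o)%N.
  by rewrite muln2 halfK oddD oddM o_odd andbT; case: (odd r); rewrite subn0.
rewrite -expnM k2 -(modn_dvdm _ pP) -[in RHS](modn_dvdm _ pP); congr (_ %% _)%N.
apply: natr_Zp_mod => //; rewrite qr natrX exprD mulnC exprM.
by rewrite (prim_expr_order l_prim) expr1n mulr1.
Qed.

(** A power of [l] has order dividing [o], whereas [g] has order [o.*2]. *)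
Lemma primitive_root_opp_power (g : int) :
  primitive_root_mod (p ^ s) g -> exists r, g%:~R = - l%:R ^+ r :> 'Z_(p ^ s).
Proof.
rewrite /primitive_root_mod /mult_order_is oE => g_prim.
have gU : (g%:~R : 'Z_(p ^ s)) \is a GRing.unit.
  by rewrite -(unitrX_pos _ (prim_order_gt0 g_prim)) prim_expr_order // unitr1.
have [r [gr|->]] := square_or_opp gU; last by exists r.
have : (o.*2 %| o)%N.
  by rewrite (prim_order_dvd g_prim) gr exprAC (prim_expr_order l_prim) expr1n.
by move/(dvdn_leq o_gt0); rewrite -addnn -{3}[o]addn0 leq_add2l leqNgt o_gt0.
Qed.

Definition signed_coset (b : bool) (i : nat) := if b then nsq_coset i else sq_coset i.

Lemma cyclotomic_coset_signed (i r : nat) (b : bool) (c : int) :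
  c%:~R = (p ^ i)%:R * ((-1) ^+ b * l%:R ^+ r) :> 'Z_(p ^ s) ->
  cyclotomic_coset (p ^ s) l c = signed_coset b i.
Proof.
move=> cE; rewrite /signed_coset.
case: b cE => cE; apply: (eq_cyclotomic_coset (r := r) o_gt0 (prim_expr_order l_prim)).
  by rewrite cE mulrNz mulN1r mulrN mulNr.
by rewrite cE mul1r.
Qed.

Lemma signed_coset_top (b : bool) : signed_coset b s = sq_coset s.
Proof.
case: b => //=; apply: (@cyclotomic_coset_signed s 0 false).
by rewrite mulrNz -pmulrn pchar_Zp // oppr0 mul0r.
Qed.
End SquareCosets.

(** * The three product formulas *)

Theorem theorem4p11 (s t p q l : nat) (g : int) (i j j' : nat)
  (s_ge1 : (1 <= s)%N) (t_ge1 : (1 <= t)%N)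
  (p_prime : prime p) (q_prime : prime q) (l_prime : prime l)
  (p_neq_q : p <> q) (p_neq_l : p <> l) (q_neq_l : q <> l)
  (p_odd : odd p) (q_odd : odd q)
  (p_mod4 : (p = 3 %[mod 4])%N)
  (ord_p : mult_order_is (p ^ s) l%:Z (totient (p ^ s) %/ 2))
  (ord_q : mult_order_is (q ^ t) l%:Z (totient (q ^ t)))
  (gcd_phi : gcdn (totient (p ^ s)) (totient (q ^ t)) = 2%N)
  (g_prim_p : primitive_root_mod (p ^ s) g)
  (g_prim_q : primitive_root_mod (q ^ t) g)
  (i_le : (i <= s - 1)%N) (j_lt : (j < j')%N) (j'_le : (j' <= t)%N) :
  let X := chi p q s t l in
  let X' := chi_star p q s t l g in
  [/\ quadratic_residue q p ->
      X' i j * X i j' =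
        ((p - 3) %/ 4 * p ^ (s - i - 1) * totient (q ^ (t - j')))%N%:R
          *: (X i j + X' i j)
        + (totient (p ^ (s - i)) %/ 2 * totient (q ^ (t - j')))%N%:R
          *: (\sum_(i.+1 <= k < s) (X k j + X' k j) + X s j),
      quadratic_nonresidue q p -> ~~ (2 %| j' - j)%N ->
      X' i j * X i j' =
        ((p - 3) %/ 4 * p ^ (s - i - 1) * totient (q ^ (t - j')))%N%:R
          *: X' i j
        + ((p + 1) %/ 4 * p ^ (s - i - 1) * totient (q ^ (t - j')))%N%:R
          *: X i j
    & quadratic_nonresidue q p -> (2 %| j' - j)%N ->
      X' i j * X i j' =
        ((p - 3) %/ 4 * p ^ (s - i - 1) * totient (q ^ (t - j')))%N%:R
          *: (X i j + X' i j)
        + (totient (p ^ (s - i)) %/ 2 * totient (q ^ (t - j')))%N%:R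
          *: (\sum_(i.+1 <= k < s) (X k j + X' k j) + X s j)].
Proof.
move=> X X'.
have P_gt1 : (1 < p ^ s)%N by rewrite -(exp1n s) ltn_exp2r // prime_gt1.
have Q_gt1 : (1 < q ^ t)%N by rewrite -(exp1n t) ltn_exp2r // prime_gt1.
have co_pq : coprime p q by rewrite prime_coprime // dvdn_prime2 //; apply/eqP.
have co_PQ : coprime (p ^ s) (q ^ t) by rewrite coprimeXl // coprimeXr.
pose o := (totient (p ^ s) %/ 2)%N.
(* Writing [p = 4 * c + 3] shows that half of [totient (p ^ s)] is odd. *)
have [c pE] : exists c, p = (4 * c + 3)%N.
  by exists (p %/ 4)%N; rewrite {1}(divn_eq p 4) p_mod4 mulnC.
have phiE : totient (p ^ s) = ((c.*2 + 1) * p ^ s.-1).*2.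
  by rewrite totient_pfactor // {1}pE; lia.
have oP : o = ((c.*2 + 1) * p ^ s.-1)%N by rewrite /o phiE -muln2 mulnK.
have o_odd : odd o by rewrite oP oddM oddD odd_double oddX p_odd orbT.
have oE : totient (p ^ s) = o.*2 by rewrite phiE oP.
have l_prim : o.-primitive_root (l%:R : 'Z_(p ^ s)) by [].
have l_primQ : (totient (q ^ t)).-primitive_root (l%:R : 'Z_(q ^ t)) by [].
have co_o : coprime o (totient (q ^ t)).
  (* This gcd divides [gcd_phi], that is 2, and the odd number [o]. *)
  have g2 : (gcdn o (totient (q ^ t)) %| 2)%N.
    by rewrite -gcd_phi dvdn_gcd dvdn_gcdr oE -muln2 dvdn_mulr ?dvdn_gcdl.
  have /primeP [_ /(_ _ g2) /pred2P [/eqP //|e]] := isT : prime 2.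
  have : (2 %| o)%N by rewrite -[2%N]e dvdn_gcdl.
  by rewrite dvdn2 o_odd.
have n_gt0 : (0 < p ^ s * q ^ t)%N by rewrite muln_gt0 !expn_gt0 !prime_gt0.
set x := (in_qpoly _ 'X : cyclic_ring l (p ^ s * q ^ t)).
have xn : x ^+ (p ^ s * q ^ t) = 1 by apply: in_qpolyX_expn.
pose y := x ^+ chinese (p ^ s) (q ^ t) 1 0.
pose z := x ^+ chinese (p ^ s) (q ^ t) 0 1.
have yP : y ^+ (p ^ s) = 1 by apply: expr_chinesel.
have zQ : z ^+ (q ^ t) = 1 by apply: expr_chineser.
have csE (d : int) : coset_sum (p ^ s * q ^ t) l d =
    power_sum y (cyclotomic_coset (p ^ s) l d)
    * power_sum z (cyclotomic_coset (q ^ t) l d).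
  by apply: (power_sum_crt _ _ _ _ (prim_expr_order l_prim) (prim_expr_order l_primQ)).
pose V k := power_sum z (gcd_class (q ^ t) (q ^ k)).
have [b gb] := primitive_root_opp_power p_prime p_odd s_ge1 o_odd l_prim oE g_prim_p.
have gQ : (g%:~R : 'Z_(q ^ t)) \is a GRing.unit.
  move: g_prim_q; rewrite /primitive_root_mod /mult_order_is => g_prim.
  by rewrite -(unitrX_pos _ (prim_order_gt0 g_prim)) prim_expr_order // unitr1.
have pQ k : ((p ^ k)%:R : 'Z_(q ^ t)) \is a GRing.unit.
  by rewrite unitZpE // coprime_sym coprimeXl // coprimeXr.
have le_jt : (j <= t)%N by apply: leq_trans (ltnW j_lt) j'_le.
have lt_is : (i < s)%N by lia.
have VM : V j * V j' = V j *+ totient (q ^ (t - j')) by apply: power_sum_gcd_classM.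
have cosetQ k m : (m <= t)%N ->
    cyclotomic_coset (q ^ t) l (p ^ k * q ^ m)%N%:Z = gcd_class (q ^ t) (q ^ m)
    /\ cyclotomic_coset (q ^ t) l ((p ^ k * q ^ m)%N%:Z * g) = gcd_class (q ^ t) (q ^ m).
  move=> le_mt; split.
    by apply: (gcd_class_coset (w := (p ^ k)%:R)) => //; rewrite -natrM mulnC.
  apply: (gcd_class_coset (w := (p ^ k)%:R * g%:~R)) => //.
    by rewrite unitrM pQ.
  by rewrite intrM mulrA -natrM mulnC.
pose S e k := power_sum y (signed_coset p s l e k).
(* The flag [e] tells whether [q] is a nonresidue. Modulo [p ^ s], the factor [q ^ m] contributes
   the sign [(-1) ^+ (e * m)] and [g] one more sign; modulo [q ^ t], the factors [p ^ k] and [g] are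
   units and leave the class unchanged. *)
have cosetE (e : bool) r k m : q%:R = (-1) ^+ e * l%:R ^+ r :> 'Z_(p ^ s) ->
    (m <= t)%N ->
    X k m = S (e && odd m) k * V m /\ X' k m = S (~~ (e && odd m)) k * V m.
  move=> qE le_mt; have [Q1 Q2] := cosetQ k m le_mt.
  have qmE : (q ^ m)%:R = (-1) ^+ (e && odd m) * l%:R ^+ (r * m) :> 'Z_(p ^ s).
    by rewrite natrX qE exprMn -!exprM -[_ ^+ (e * m)]signr_odd oddM oddb.
  rewrite /X /X' /chi /chi_star !csE Q1 Q2.
  rewrite /S /V; split; congr (power_sum y _ * _).
    apply: (cyclotomic_coset_signed (r := r * m) l_prim) => //.
    by rewrite -pmulrn natrM qmE.
  apply: (cyclotomic_coset_signed (r := r * m + b) l_prim) => //.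
  rewrite intrM -pmulrn natrM qmE gb signrN exprD.
  by ring.
pose M := power_sum y (multiples (p ^ s) (p ^ i.+1)).
have sumE (e : bool) r k : q%:R = (-1) ^+ e * l%:R ^+ r :> 'Z_(p ^ s) ->
    X k j + X' k j = (power_sum y (sq_coset p s l k) + power_sum y (nsq_coset p s l k)) * V j.
  move=> qE; have [-> ->] := cosetE e r k j qE le_jt; rewrite -mulrDl.
  by case: (e && odd j) => //; congr (_ * _); apply: addrC.
have tailE (e : bool) r : q%:R = (-1) ^+ e * l%:R ^+ r :> 'Z_(p ^ s) ->
    \sum_(i.+1 <= k < s) (X k j + X' k j) + X s j = M * V j.
  move=> qE; rewrite /M (@power_sum_multiples p s l o) // mulrDl mulr_suml.
  congr (_ + _); first by apply: eq_bigr => k _; apply: sumE qE.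
  by have [-> _] := cosetE e r s j qE le_jt; rewrite /S (@signed_coset_top p s l o).
(* Cases (i) and (iii) together: [q ^ j] and [q ^ j'] carry the same sign, so the two factors in [y]
   belong to opposite classes. *)
have mixed (e : bool) r : q%:R = (-1) ^+ e * l%:R ^+ r :> 'Z_(p ^ s) ->
    e && odd (j' - j) = false ->
    X' i j * X i j' =
        ((p - 3) %/ 4 * p ^ (s - i - 1) * totient (q ^ (t - j')))%N%:R
          *: (X i j + X' i j)
        + (totient (p ^ (s - i)) %/ 2 * totient (q ^ (t - j')))%N%:R
          *: (\sum_(i.+1 <= k < s) (X k j + X' k j) + X s j).
  move=> qE jj'; rewrite !scaler_nat (tailE e r qE) (sumE e r i qE).
  have [_ ->] := cosetE e r i j qE le_jt; have [-> _] := cosetE e r i j' qE j'_le.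
  have -> : e && odd j' = e && odd j.
    by move: jj'; case: (e) => //=; rewrite oddB 1?ltnW //; case: odd; case: odd.
  rewrite mulrACA VM.
  have -> : S (~~ (e && odd j)) i * S (e && odd j) i
      = power_sum y (nsq_coset p s l i) * power_sum y (sq_coset p s l i).
    by case: (e && odd j) => //; apply: mulrC.
  rewrite (@power_sum_sq_nsq p s l o) // -/M.
  by ring.
split.
- move=> /(residue_power p_prime p_odd s_ge1 o_odd l_prim oE) [r qE].
  by apply: (mixed false r); rewrite ?mul1r.
- move=> /(nonresidue_power p_prime p_odd s_ge1 o_odd l_prim oE) [r qE].
  have {}qE : q%:R = (-1) ^+ true * l%:R ^+ r :> 'Z_(p ^ s) by rewrite mulN1r.
  rewrite dvdn2 negbK oddB 1?ltnW // => jj'; rewrite !scaler_nat.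
  have [-> ->] := cosetE true r i j qE le_jt; have [-> _] := cosetE true r i j' qE j'_le.
  (* Here [j] and [j'] have opposite parities, so both factors in [y] belong to the same class and a
     square appears. *)
  rewrite !andTb; have -> : odd j' = ~~ odd j by move: jj'; case: odd; case: odd.
  rewrite mulrACA VM.
  have -> : S (~~ odd j) i * S (~~ odd j) i
    = S (~~ odd j) i *+ ((p - 3) %/ 4 * p ^ (s - i - 1))
    + S (odd j) i *+ ((p + 1) %/ 4 * p ^ (s - i - 1)).
    rewrite /S; case: (odd j).
      by apply: (@power_sum_sq_sq p s l o).
    by apply: (@power_sum_nsq_nsq p s l o).
  by ring.
move=> /(nonresidue_power p_prime p_odd s_ge1 o_odd l_prim oE) [r qE].
rewrite dvdn2 => /negbTE jj'.
by apply: (mixed true r); rewrite ?mulN1r.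
Qed.
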